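(* Assume that the distribution of $Z$ is aperiodic (the greatest common divisor of its support is $1$), that $\mathbb{E} Z=\infty$, and that $\mathbb{E}\min(Z,W)<\infty$. Then $\Lambda_n\to\infty$ almost surely as $n\to\infty$.
   Context: Let $Z,W,(Z_n)_{n\ge1},(W_n)_{n\ge1}$ be independent, identically distributed random variables taking values in $\mathbb{N}=\{1,2,3,\dots\}$. Define sets $T_n\subset\mathbb{Z}$ recursively by $T_n=\{n\}$ for $n\le 0$ and $T_n=\{n\}\cup T_{n-Z_n}\cup T_{n-W_n}$ for $n\ge1$. Let $\mathcal{L}_n=T_n\cap\{0,-1,-2,\dots\}$ and $\Lambda_n=|\mathcal{L}_n|$. *)

(* Defs.v *)
From HB Require Import structures.
From mathcomp Require Import all_boot all_order all_algebra.
From mathcomp Require Import finmap.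
From mathcomp Require Import all_classical all_reals all_analysis.
Set Implicit Arguments. Unset Strict Implicit. Unset Printing Implicit Defensive.
Import Order.TTheory GRing.Theory Num.Theory.
Local Open Scope classical_set_scope.
Local Open Scope ring_scope.

Definition mutually_independent d (T : measurableType d) (R : realType)
  (P : probability T R) (I : choiceType) (X : I -> T -> nat) : Prop :=
  forall (J : {fset I}) (A : I -> set nat),
    P (\bigcap_(i in [set` J]) (X i @^-1` A i)) =
    (\prod_(i <- J) P (X i @^-1` A i))%E.

Definition identically_distributed d (T : measurableType d) (R : realType)
  (P : probability T R) (I : Type) (X : I -> T -> nat) : Prop :=
  forall (i j : I) (A : set nat), P (X i @^-1` A) = P (X j @^-1` A).

Definition ZWfamily (T : Type) (Z W : T -> nat) (Zs Ws : nat -> T -> nat)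
  (i : bool + (bool * nat)) : T -> nat :=
  match i with
  | inl true => Z
  | inl false => W
  | inr (true, n) => Zs n.+1
  | inr (false, n) => Ws n.+1
  end.

(* inT z w n m  <->  m belongs to T_n, where T_n = {n} for n <= 0 and
   T_n = {n} U T_{n - z n} U T_{n - w n} for n >= 1
   (the least, and by well-foundedness unique, solution of the recursion). *)
Inductive inT (z w : nat -> nat) : int -> int -> Prop :=
| inT_self n : inT z w n n
| inT_Z n m : 0 < n -> inT z w (n - (z `|n|%N)%:Z) m -> inT z w n m
| inT_W n m : 0 < n -> inT z w (n - (w `|n|%N)%:Z) m -> inT z w n m.

Definition Tset (z w : nat -> nat) (n : int) : set int := [set m | inT z w n m].

(* L_n = T_n ∩ {0,-1,-2,...} and Lambda_n = |L_n| (T_n is finite). *)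
Definition Lset (z w : nat -> nat) (n : int) : set int :=
  Tset z w n `&` [set m : int | m <= 0].

Definition Lambda (z w : nat -> nat) (n : int) : nat := #|` fset_set (Lset z w n)|.

(* Main.v *)
(* Call a site k a cut if T_k is a subset of T_n for every n >= k + C. Let Q be
   the semigroup generated by the support of Z; by aperiodicity it contains
   every integer >= C. Then k is a cut as soon as, for each i > 0 in Q, one of
   the two steps at k + i lands at a site k + j with j in Q. These conditions
   are independent over i, each has positive probability, and the i-th one holds
   whenever min(Z, W) <= i - C; so E min(Z, W) < oo bounds the probability of
   all of them together below by some delta > 0, uniformly in k and
   independently of the steps at sites <= k. As E Z = oo, for each M infinitely
   many sites k satisfy Z_k >= k + M; the first one beyond any given time is a
   cut with conditional probability at least delta, hence almost surely some
   such k is a cut. Each of them contributes a leaf <= -M to all L_n with n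
   large, so L_n eventually contains any prescribed number of leaves. *)
Require Import Defs.
From HB Require Import structures.
From mathcomp Require Import all_boot all_order all_algebra.
From mathcomp Require Import finmap.
From mathcomp Require Import all_classical all_reals all_analysis.
From mathcomp Require Import measurable_realfun zify lra.
Set Implicit Arguments.
Unset Strict Implicit.
Unset Printing Implicit Defensive.
Import Order.TTheory GRing.Theory Num.Theory.
Local Open Scope classical_set_scope.
Local Open Scope ring_scope.

(** * Numerical semigroups whose generators have gcd 1 *)

Inductive sums_of (S : set nat) : nat -> Prop :=
| sums_of0 : sums_of S 0%N
| sums_ofD s m : S s -> sums_of S m -> sums_of S (s + m)%N.

Lemma sums_of_add (S : set nat) m n :
  sums_of S m -> sums_of S n -> sums_of S (m + n)%N.
Proof.
move=> Sm Sn; elim: Sm => [|s m' Ss _ IH]; first by rewrite add0n.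
by rewrite -addnA; exact: sums_ofD.
Qed.

Lemma sums_of_mul (S : set nat) m t : sums_of S m -> sums_of S (t * m)%N.
Proof.
move=> Sm; elim: t => [|t IH]; first by rewrite mul0n; exact: sums_of0.
by rewrite mulSn; exact: sums_of_add.
Qed.

(* The least positive difference g of two elements a, a + g of the semigroup
   divides every generator s: a remainder r = s - t g > 0 would be the
   difference of t a + s and t (a + g). *)
Lemma sums_of_eventually (S : set nat) :
  (forall k, (forall m, S m -> (k %| m)%N) -> k = 1%N) ->
  exists C, forall m, (C <= m)%N -> sums_of S m.
Proof.
move=> gcd1.
pose D : pred nat := fun g => `[< (0 < g)%N /\
  exists a, sums_of S a /\ sums_of S (a + g)%N >].
have exD : exists g, D g.
  apply: contrapT => nD.
  (* Without a positive difference every generator is 0, hence divisible by 2. *)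
  suff : 2%N = 1%N by [].
  apply: gcd1 => -[//|m] Sm; exfalso; apply: nD; exists m.+1.
  apply/asboolP; split => //; exists 0%N; split; first exact: sums_of0.
  rewrite add0n -[m.+1]addn0; apply: sums_ofD => //; exact: sums_of0.
case: (ex_minnP exD) => g /asboolP[g0 [a [Sa Sag]]] gmin.
have g1 : g = 1%N.
  apply: gcd1 => s Ss; apply: contrapT => ndvd.
  have r0 : (0 < s %% g)%N by rewrite lt0n; apply/negP; exact: ndvd.
  suff : D (s %% g)%N by move=> /gmin; rewrite leqNgt ltn_mod g0.
  apply/asboolP; split=> //; exists (s %/ g * (a + g))%N; split.
    exact: sums_of_mul.
  have -> : (s %/ g * (a + g) + s %% g = s + s %/ g * a)%N.
    by rewrite mulnDr -addnA -divn_eq addnC.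
  by apply: sums_ofD => //; exact: sums_of_mul.
(* Now a and a + 1 are in the semigroup. For a > 0 and m = u a + r with r < a, m = (u - r) a + r (a
   + 1), where m >= a * a gives u >= a > r. *)
rewrite g1 in Sag; exists (a * a)%N => m am.
have [a0|a0] := posnP a.
  by rewrite -[m]muln1; apply: sums_of_mul; rewrite a0 in Sag.
have ltr : (m %% a < a)%N by rewrite ltn_mod.
have leq : (a <= m %/ a)%N by rewrite leq_divRL.
have -> : (m = (m %/ a - m %% a) * a + m %% a * (a + 1))%N.
  rewrite mulnBl mulnDr muln1 addnA subnK -?divn_eq// leq_mul2r.
  by rewrite (leq_trans (ltnW ltr)) ?orbT.
by apply: sums_of_add; exact: sums_of_mul.
Qed.

(** * Reachable sites: finiteness, cuts and leaves *)

Lemma inT_trans z w n m l : inT z w n m -> inT z w m l -> inT z w n l.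
Proof.
elim=> // [n' m' n0 _ IH|n' m' n0 _ IH] /IH ?; [exact: inT_Z|exact: inT_W].
Qed.

Lemma inT_nonpos z w n m : n <= 0 -> inT z w n m -> m = n.
Proof. by move=> n0 H; case: H n0 => // ? ? ? _ ?; lia. Qed.

(** Positive steps strictly lower the site, so induction on an upper bound [N] of [n] works. On an
    infinite set [fset_set], and with it [Lambda], would take a default value. *)
Lemma finite_Tset z w : (forall j, 0 < z j.+1 /\ 0 < w j.+1)%N ->
  forall n, finite_set (Tset z w n).
Proof.
move=> pos n; have [N] : exists N : nat, n <= N%:Z by exists `|n|%N; lia.
elim: N n => [|N IH] n nN.
  by apply: (@sub_finite_set _ _ [set n]) => // m /(inT_nonpos nN) ->.
have [n0|n0] := leP n 0.
  by apply: (@sub_finite_set _ _ [set n]) => // m /(inT_nonpos n0) ->.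
have [z0 w0] : (0 < z `|n| /\ 0 < w `|n|)%N.
  by have := pos `|n|.-1%N; rewrite prednK//; lia.
apply: (@sub_finite_set _ _ ([set n] `|`
  (Tset z w (n - (z `|n|%N)%:Z) `|` Tset z w (n - (w `|n|%N)%:Z)))).
  move=> m H; move: n0 z0 w0 nN; case: n m / H; first by left.
  - by move=> n m _ H *; right; left.
  - by move=> n m _ H *; right; right.
by rewrite !finite_setU; split => //; split; apply: IH; lia.
Qed.

(** The guards make the condition vacuous at distance 0 and at distances outside the semigroup, so
    it can be required at every [i]. *)
Definition good_step (S : set nat) (i : nat) : set nat :=
  [set s | (0 < i)%N -> sums_of S i -> (0 < s <= i)%N /\ sums_of S (i - s)].

(** A good step leads to a smaller distance that is again in the semigroup; strong induction ends at
    distance 0, the site [k]. *)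
Lemma inT_good_steps (S : set nat) z w k :
  (forall i, good_step S i (z (k + i)%N) \/ good_step S i (w (k + i)%N)) ->
  forall i, sums_of S i -> inT z w (k + i)%N%:Z k%:Z.
Proof.
move=> good i; elim/ltn_ind: i => -[|i] IH Si.
  by rewrite addn0; exact: inT_self.
case: (good i.+1) => /(_ isT Si) [/andP[s0 si] /IH H].
- apply: inT_Z; first lia.
  rewrite absz_nat; have -> : (k + i.+1)%N%:Z - (z (k + i.+1)%N)%:Z =
    (k + (i.+1 - z (k + i.+1)))%N by lia.
  by apply: H; lia.
- apply: inT_W; first lia.
  rewrite absz_nat; have -> : (k + i.+1)%N%:Z - (w (k + i.+1)%N)%:Z =
    (k + (i.+1 - w (k + i.+1)))%N by lia.
  by apply: H; lia.
Qed.

(** A cut passes its leaf [k.+1 - z k.+1 <= - M] on to all large [n]. Taking [- M] strictly below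
    the leaves already found makes this leaf new. *)
Lemma Lambda_ge z w C : (forall j, 0 < z j.+1 /\ 0 < w j.+1)%N ->
  (forall M : nat, exists k : nat, (k.+1 + M <= z k.+1)%N /\
     forall n : nat, (k.+1 + C <= n)%N -> inT z w n%:Z k.+1%:Z) ->
  forall K, \forall n \near \oo, (K <= Lambda z w n%:Z)%N.
Proof.
move=> pos cut K.
suff [s [sK us [N [M [_ sL]]]]] : exists s : seq int, [/\ size s = K, uniq s &
    exists N : nat, exists M : nat, {in s, forall y, - M%:Z < y} /\
    forall n : nat, (N <= n)%N -> {in s, forall y, Lset z w n%:Z y}].
  exists N => // n /= Nn; rewrite -sK.
  have -> : size s = #|` [fset y in s]%fset| by rewrite card_fseq undup_id.
  apply: fsubset_leq_card; apply/fsubsetP => y; rewrite !inE /= => ys.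
  rewrite in_fset_set; first by rewrite inE; exact: sL.
  exact/finite_setIl/finite_Tset.
elim: K => [|K [s [sK us [N [M [sM sL]]]]]].
  by exists [::]; split=> //; exists 0%N, 0%N; split.
have [k [kM kC]] := cut M.
set y := k.+1%:Z - (z k.+1)%:Z.
have yM : y <= - M%:Z by rewrite /y; lia.
exists (y :: s); split; first by rewrite /= sK.
  by rewrite /= us andbT; apply/negP => /sM; lia.
exists (maxn N (k.+1 + C)%N), `|y|.+1%N; split.
  by move=> u; rewrite inE => /orP[/eqP->|/sM]; lia.
move=> n; rewrite geq_max => /andP[Nn kn] u; rewrite inE => /orP[/eqP->|us'].
  split; last by rewrite /=; lia.
  apply: inT_trans (kC _ kn) _; apply: inT_Z; first by lia.
  exact: inT_self.
exact: sL.
Qed.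

(** * Finite intersections of events, and probabilities as real numbers *)

Lemma bigcap_lt0 (T : Type) (E : nat -> set T) :
  \bigcap_(i in [set i | (i < 0)%N]) E i = setT.
Proof. by rewrite bigcap_mkord big_ord0. Qed.

Lemma bigcap_ltS (T : Type) (E : nat -> set T) n :
  \bigcap_(i in [set i | (i < n.+1)%N]) E i =
  (\bigcap_(i in [set i | (i < n)%N]) E i) `&` E n.
Proof. by rewrite !bigcap_mkord big_ord_recr. Qed.

Lemma bigcup_ltS (T : Type) (E : nat -> set T) n :
  \bigcup_(i in [set i | (i < n.+1)%N]) E i =
  (\bigcup_(i in [set i | (i < n)%N]) E i) `|` E n.
Proof. by rewrite !bigcup_mkord big_ord_recr. Qed.

Section fine_probability.
Context d (T : measurableType d) (R : realType) (P : probability T R).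
Implicit Types A B : set T.

Lemma fine_probability_ge0 A : 0 <= fine (P A).
Proof. exact: fine_ge0. Qed.

Lemma le_fine_probability A B : measurable A -> measurable B ->
  A `<=` B -> fine (P A) <= fine (P B).
Proof.
by move=> mA mB AB; rewrite fine_le ?fin_num_measure// le_measure ?inE.
Qed.

Lemma fine_probabilityU A B : measurable A -> measurable B ->
  A `&` B = set0 -> fine (P (A `|` B)) = fine (P A) + fine (P B).
Proof. by move=> mA mB AB; rewrite measureU// fineD ?fin_num_measure. Qed.

Lemma fine_probabilityID A B : measurable A -> measurable B ->
  fine (P A) = fine (P (A `&` B)) + fine (P (A `&` ~` B)).
Proof.
move=> mA mB; rewrite -fine_probabilityU.
- by rewrite -setIUr setUCr setIT.
- exact: measurableI.
- by apply: measurableI => //; exact: measurableC.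
- by rewrite setIACA setICr setI0.
Qed.

Lemma fine_probability_bigcap_ge (E : nat -> set T) c :
  (forall n, measurable (E n)) -> {homo E : n m / (n <= m)%N >-> m `<=` n} ->
  (forall n, c <= fine (P (E n))) -> c <= fine (P (\bigcap_n E n)).
Proof.
move=> mE niE cE; have mcap : measurable (\bigcap_n E n).
  exact: bigcapT_measurable.
rewrite -lee_fin fineK ?fin_num_measure//.
have cvgE : P (E n) @[n --> \oo] --> P (\bigcap_n E n).
  apply: nonincreasing_cvg_mu => //.
    by rewrite (le_lt_trans (probability_le1 P _))// ltry.
  by move=> n m nm; apply/subsetPset; exact: niE.
rewrite -(cvg_lim _ cvgE)//; apply: lime_ge; first exact: cvgP cvgE.
by apply: nearW => n; rewrite -(@fineK _ (P (E n))) ?fin_num_measure// lee_fin.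
Qed.

Lemma fine_probability_bigcup_le (E : nat -> set T) c :
  (forall n, measurable (E n)) -> {homo E : n m / (n <= m)%N >-> n `<=` m} ->
  (forall n, fine (P (E n)) <= c) -> fine (P (\bigcup_n E n)) <= c.
Proof.
move=> mE ndE cE; have mcup : measurable (\bigcup_n E n).
  exact: bigcupT_measurable.
rewrite -lee_fin fineK ?fin_num_measure//.
have cvgE : P (E n) @[n --> \oo] --> P (\bigcup_n E n).
  apply: nondecreasing_cvg_mu => //.
  by move=> n m nm; apply/subsetPset; exact: ndE.
rewrite -(cvg_lim _ cvgE)//; apply: lime_le; first exact: cvgP cvgE.
by apply: nearW => n; rewrite -(@fineK _ (P (E n))) ?fin_num_measure// lee_fin.
Qed.

End fine_probability.

(** * Abstract form: almost surely some marked index is a cut *)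

Section marked_cuts.
Context d (T : measurableType d) (R : realType) (P : probability T R).
(** [F k] holds the events known before index [k] is revealed, [G k] is the mark at [k], and [B k i]
    is the [i]-th cut condition for [k], revealed at index k + i + 1. Their conditional
    probabilities given the past are [g k] and [q i]. *)
Context (F : nat -> set (set T)) (G : nat -> set T) (B : nat -> nat -> set T).
Context (g q : nat -> R) (delta : R).
Hypothesis F_measurable : forall k A, F k A -> measurable A.
Hypothesis F_S : forall k A, F k A -> F k.+1 A.
Hypothesis FT : forall k, F k setT.
Hypothesis FC : forall k A, F k A -> F k (~` A).
Hypothesis FI : forall k A A', F k A -> F k A' -> F k (A `&` A').
Hypothesis FG : forall k, F k.+1 (G k).
Hypothesis FB : forall k i, F (k + i).+2 (B k i).
Hypothesis indepG : forall k A, F k A -> fine (P (A `&` G k)) = fine (P A) * g k.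
Hypothesis indepB : forall k i A, F (k + i).+1 A ->
  fine (P (A `&` B k i)) = fine (P A) * q i.
Hypothesis delta_gt0 : 0 < delta.
Hypothesis prodq : forall n, delta <= \prod_(i < n) q i.
Hypothesis prodg : forall m e, 0 < e ->
  exists n, \prod_(i < n) (1 - g (m + i)%N) <= e.

Let F_le m n A : (m <= n)%N -> F m A -> F n A.
Proof. by move=> /subnK <- FA; elim: (n - m)%N => //= k; exact: F_S. Qed.

Let F_bigcap k n (E : nat -> set T) :
  (forall i, (i < n)%N -> F k (E i)) -> F k (\bigcap_(i < n) E i).
Proof.
elim: n => [|n IH] FE; first by rewrite bigcap_lt0; exact: FT.
rewrite bigcap_ltS.
apply: FI; last exact: FE.
by apply: IH => i ltin; apply: FE; exact: ltnW.
Qed.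

Let cut k := \bigcap_i B k i.
Let cutn k n := \bigcap_(i < n) B k i.

Let F_cutn k n : F (k + n).+1 (cutn k n).
Proof.
by apply: F_bigcap => i ltin; apply: F_le (FB k i); rewrite ltnS ltn_add2l.
Qed.

Let measurable_cut k : measurable (cut k).
Proof. by apply: bigcapT_measurable => i; exact: F_measurable (FB k i). Qed.

(** Revealing the conditions one at a time multiplies the probability by [q i] each time; continuity
    from above passes to all of them. *)
Let cut_ge k A : F k.+1 A -> delta * fine (P A) <= fine (P (A `&` cut k)).
Proof.
move=> FA.
have FAn n : F (k + n).+1 (A `&` cutn k n).
  by apply: FI => //; apply: F_le FA; rewrite ltnS leq_addr.
have PAn n : fine (P (A `&` cutn k n)) = fine (P A) * \prod_(i < n) q i.
  elim: n => [|n IH]; first by rewrite /cutn bigcap_lt0 setIT big_ord0 mulr1.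
  rewrite /cutn bigcap_ltS setIA indepB//.
  by rewrite IH big_ord_recr/= mulrA.
have -> : A `&` cut k = \bigcap_n (A `&` cutn k n).
  apply/seteqP; split=> [x [Ax Rx] n _|x Rx].
    by split => // i _; exact: Rx.
  by split=> [|i _]; [case: (Rx 0%N I)|case: (Rx i.+1 I) => _; apply => /=].
apply: fine_probability_bigcap_ge => [n|n m nm x [Ax Rx]|n].
- exact: F_measurable (FAn n).
- by split=> // i /= ltin; apply: Rx => /=; exact: leq_trans nm.
- by rewrite PAn mulrC ler_wpM2l// fine_probability_ge0.
Qed.

Let E k := G k `&` cut k.
Let D := \bigcup_k E k.

Let mG k : measurable (G k). Proof. exact: F_measurable (FG k). Qed.
Let mE k : measurable (E k). Proof. exact: measurableI. Qed.
Let mD : measurable D. Proof. exact: bigcupT_measurable. Qed.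

(* Stop at the first marked index after m: its cut event is independent of
   the past, which already knows that index. *)
Let first_mark_ge m A : F m A -> delta * fine (P A) <= fine (P (A `&` D)).
Proof.
move=> FA; have mA := F_measurable FA.
(* [A] holds and none of m, ..., m + n - 1 is marked. *)
pose An n := A `&` \bigcap_(i < n) ~` G (m + i)%N.
have FAn n : F (m + n)%N (An n).
  apply: FI; first by apply: F_le FA; rewrite leq_addr.
  apply: F_bigcap => i ltin; apply: FC; apply: F_le (FG _).
  by rewrite ltn_add2l.
have mAn n := F_measurable (FAn n).
have AnS n : An n.+1 = An n `&` ~` G (m + n)%N.
  by rewrite /An bigcap_ltS setIA.
have PAnS n :
    fine (P (An n `&` G (m + n)%N)) = fine (P (An n)) - fine (P (An n.+1)).
  by rewrite AnS (fine_probabilityID P (mAn n) (mG (m + n)%N)) addrK.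
have PAn n : fine (P (An n)) = fine (P A) * \prod_(i < n) (1 - g (m + i)%N).
  elim: n => [|n IH]; first by rewrite /An bigcap_lt0 setIT big_ord0 mulr1.
  move: (PAnS n); rewrite indepG// big_ord_recr/= IH => /eqP.
  by rewrite eq_sym subr_eq => /eqP; lra.
have mU n : measurable (\bigcup_(i < n) E (m + i)%N).
  exact: bigcup_measurable.
(* Within [A], the events that the first mark from m on is at m + n are disjoint, their
   probabilities telescope, and [cut_ge] applies to each. *)
have lb n : delta * (fine (P A) - fine (P (An n))) <=
    fine (P (A `&` \bigcup_(i < n) E (m + i)%N)).
  elim: n => [|n IH].
    by rewrite /An bigcap_lt0 setIT subrr mulr0 fine_probability_ge0.
  have : delta * (fine (P (An n)) - fine (P (An n.+1))) <=
      fine (P (An n `&` E (m + n)%N)).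
    by rewrite -PAnS setIA; apply: cut_ge; apply: FI => //; exact: F_S.
  rewrite bigcup_ltS.
  set U := \bigcup_(i < n) _ in IH *.
  have mAU : measurable (A `&` U) by exact: measurableI (mU n).
  have mAE : measurable (An n `&` E (m + n)%N) by exact: measurableI.
  have := @fine_probabilityU _ _ _ P (A `&` U) (An n `&` E (m + n)%N) mAU mAE.
  have -> : (A `&` U) `&` (An n `&` E (m + n)%N) = set0.
    by apply/seteqP; split=> // x [[_ [i ltin [Gx _]]] [[_ /(_ i ltin)]]].
  move=> /(_ erefl) UE.
  have : fine (P ((A `&` U) `|` (An n `&` E (m + n)%N))) <=
     fine (P (A `&` (U `|` E (m + n)%N))).
    apply: le_fine_probability; first exact: measurableU.
    - by apply: measurableI => //; apply: measurableU => //; exact: mU.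
    - by move=> x [[Ax Ux]|[[Ax _] Ex]]; split=> //; [left|right].
  by rewrite UE; lra.
have lb' n : delta * (fine (P A) - fine (P (An n))) <= fine (P (A `&` D)).
  apply: le_trans (lb n) _; apply: le_fine_probability.
  - exact: measurableI.
  - exact: measurableI.
  - by apply: setIS => x [i _ Ex]; exists (m + i)%N.
(* The part of [A] still unmarked is made so small that it costs at most [e] after multiplication by
   [delta]. *)
apply/ler_addgt0Pr => e e0; have [n] := prodg m (divr_gt0 e0 delta_gt0).
rewrite ler_pdivlMr// => ge; have := lb' n; rewrite PAn.
suff : fine (P A) * (\prod_(i < n) (1 - g (m + i)%N) * delta) <= 1 * e by nra.
have [p0|p0] := leP 0 (\prod_(i < n) (1 - g (m + i)%N)).
  apply: ler_pM => //; first exact: fine_probability_ge0.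
    by rewrite mulr_ge0// ltW.
  by rewrite -lee_fin fineK ?fin_num_measure// probability_le1.
rewrite mul1r (le_trans _ (ltW e0))// mulr_ge0_le0 ?fine_probability_ge0//.
by rewrite mulr_le0_ge0// ltW.
Qed.

(** Outside [D] every marked k < N is refuted after finitely many conditions. Once these are
    refuted, a later marked cut still has conditional probability at least [delta]. Hence [delta]
    times the probability of missing [D] is at most that of [D] without [DN N], which tends to 0 as
    N grows. *)
Lemma ae_marked_cut : {ae P, forall x, exists k, G k x /\ forall i, B k i x}.
Proof.
suff PD : fine (P (~` D)) <= 0.
  exists (~` D); split; first exact: measurableC.
    apply/eqP; rewrite eq_le measure_ge0 andbT.
    rewrite -(@fineK _ (P (~` D))) ?fin_num_measure ?lee_fin//.
    exact: measurableC.
  apply: subsetC => x [k _ [Gx Rx]]; exists k; split=> // i; exact: Rx.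
pose DN N := \bigcup_(k < N) E k.
have mDN N : measurable (D `\` DN N).
  by apply: measurableD => //; exact: bigcup_measurable.
suff lb N : delta * fine (P (~` D)) <= fine (P (D `\` DN N)).
  rewrite -(pmulr_rle0 _ delta_gt0).
  apply: (le_trans (@fine_probability_bigcap_ge _ _ _ P
    (fun N => D `\` DN N) _ mDN _ lb)).
    move=> n m nm x [Dx nx]; split=> // -[k /= km Ex]; apply: nx.
    by exists k => //=; exact: leq_trans nm.
  rewrite (_ : \bigcap_n _ = set0) ?measure0//.
  apply/seteqP; split=> // x DNx; have [[k _ Ex] _] := DNx 0%N I.
  by have [_] := DNx k.+1 I; apply; exists k => /=.
(* Each marked k < N already violates one of its first [m] conditions: an event of the past, to
   which [first_mark_ge] applies. *)
pose A m := \bigcap_(k < N) ~` (G k `&` cutn k m).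
have FA m : F (N + m).+1 (A m).
  apply: F_bigcap => k ltkN; apply: FC; apply: FI.
    by apply: F_le (FG k); lia.
  by apply: F_le (F_cutn k m); lia.
have mA m := F_measurable (FA m).
have ADN m : A m `&` D `<=` D `\` DN N.
  move=> x [Ax Dx]; split=> // -[k ltkN [Gx Rx]]; apply: (Ax k ltkN).
  by split=> // i _; exact: Rx.
have AD m : fine (P (A m)) <= fine (P (D `\` DN N)) / delta.
  rewrite ler_pdivlMr// mulrC (le_trans (first_mark_ge (FA m)))//.
  by apply: le_fine_probability => //; exact: measurableI.
rewrite mulrC -ler_pdivlMr//.
have ndA : {homo A : n m / (n <= m)%N >-> n `<=` m}.
  move=> n m nm x Ax k ltkN [Gx Rx]; apply: (Ax k ltkN); split=> // i /= ltin.
  by apply: Rx => /=; exact: leq_trans nm.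
apply: le_trans (fine_probability_bigcup_le mA ndA AD).
apply: le_fine_probability.
- exact: measurableC.
- exact: bigcupT_measurable.
move=> x nDx; rewrite {AD ADN mA FA ndA}/A {mDN DN}.
(* Finitely many indices are refuted, so one [m] exceeds the positions of all their failures. *)
elim: N => [|N [m _ IH]]; first by exists 0%N.
have [Gx|nGx] := pselect (G N x); last first.
  exists m => // k; rewrite /= ltnS leq_eqVlt => /orP[/eqP-> []//|]; exact: IH.
have [i nB] : exists i, ~ B N i x.
  apply: contrapT => nB; apply: nDx; exists N => //; split=> // i _.
  by apply: contrapT => nBi; apply: nB; exists i.
exists (maxn m i.+1) => // k; rewrite /= ltnS leq_eqVlt.
move=> /orP[/eqP-> [_ Rx]|ltkN [Gkx Rx]].
  by apply: nB; apply: Rx; rewrite /= leq_max ltnSn orbT.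
apply: (IH k ltkN); split=> // j /= ltjm; apply: Rx => /=.
exact: leq_trans (leq_maxl _ _).
Qed.

End marked_cuts.

(** * Infinite products, from the Weierstrass product inequality on *)

Lemma prod_ge_1subsum (R : realType) (q : nat -> R) n :
  (forall i, 0 <= q i <= 1) ->
  1 - \sum_(i < n) (1 - q i) <= \prod_(i < n) q i.
Proof.
move=> q01; elim: n => [|n IH]; first by rewrite !big_ord0 subr0.
rewrite !big_ord_recr/=; set s := \sum_(i < n) _ in IH *.
set p := \prod_(i < n) _ in IH *.
have p1 : p <= 1 by apply: Num.Theory.prodr_ile1 => i _; exact: q01.
have p0 : 0 <= p by apply: prodr_ge0 => i _; case/andP: (q01 i).
have := q01 n; nra.
Qed.

(** Once at most 1/2 of the sum is left, the Weierstrass inequality keeps the tail product above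
    1/2. The earlier factors are positive, and [delta] is half their product. *)
Lemma prod_lower_bound (R : realType) (q a : nat -> R) C c :
  (forall i, 0 < q i <= 1) -> (forall i, 1 - q (C + i)%N <= a i) ->
  (forall n, \sum_(i < n) a i <= c) ->
  exists2 delta, 0 < delta & forall n, delta <= \prod_(i < n) q i.
Proof.
move=> q01 qa ac.
have a0 i : 0 <= a i by have := qa i; have := q01 (C + i)%N; lra.
pose s n := \sum_(i < n) a i.
have ubs : has_sup (range s).
  by split; [exists (s 0%N), 0%N|exists c => _ [n _ <-]; exact: ac].
have half0 : (0 : R) < 2^-1 by rewrite invr_gt0.
have [_ [N _ <-] sN] := sup_adherent half0 ubs.
have tail n : \sum_(i < n) (1 - q (C + N + i)%N) <= 2^-1.
  apply: (@le_trans _ _ (\sum_(i < n) a (N + i)%N)).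
    by apply: ler_sum => i _; rewrite -addnA; exact: qa.
  have : s (N + n)%N <= sup (range s).
    by apply: sup_upper_bound => //; exists (N + n)%N.
  by rewrite {1}/s big_split_ord/=; rewrite -/(s N); lra.
move: (C + N)%N tail => M tail; exists (\prod_(i < M) q i / 2).
  by rewrite divr_gt0// prodr_gt0// => i _; case/andP: (q01 i).
move=> n; have p0 m : 0 <= \prod_(i < m) q i.
  by apply: prodr_ge0 => i _; rewrite ltW//; case/andP: (q01 i).
(* Factors at most 1: appending [M] of them only lowers the product, and now the first [M] can be
   split off. *)
apply: (@le_trans _ _ (\prod_(i < n + M) q i)); last first.
  rewrite big_split_ord/=; apply: ler_piMr; first exact: p0.
  apply: Num.Theory.prodr_ile1 => i _.
  by have := q01 (n + i)%N; lra.
rewrite (addnC n) big_split_ord/=; apply: ler_wpM2l; first exact: p0.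
have q01' i : 0 <= q (M + i)%N <= 1 by have := q01 (M + i)%N; lra.
have := @prod_ge_1subsum _ (fun i => q (M + i)%N) n q01'; have := tail n; lra.
Qed.

(** Since (1 - g)(1 + g) <= 1, induction bounds the product times 1 plus the sum by 1; a sum of at
    least 1/e then leaves a product of at most e. *)
Lemma prod_1sub_small (R : realType) (g : nat -> R) :
  (forall i, 0 <= g i <= 1) -> (forall c, exists n, c <= \sum_(i < n) g i) ->
  forall e, 0 < e -> exists n, \prod_(i < n) (1 - g i) <= e.
Proof.
move=> g01 gc e e0; have [n gn] := gc e^-1; exists n.
suff le1 : \prod_(i < n) (1 - g i) * (1 + \sum_(i < n) g i) <= 1.
  set p := \prod_(i < n) _ in le1 *; set s := \sum_(i < n) _ in gn le1.
  have p0 : 0 <= p by apply: prodr_ge0 => i _; have := g01 i; lra.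
  have es : 1 <= s * e by rewrite -ler_pdivrMr// mul1r.
  have : p * 1 <= p * (s * e) by apply: ler_wpM2l.
  have : (p * s) * e <= 1 * e by apply: ler_wpM2r; [exact: ltW|nra].
  lra.
elim: n {gn} => [|n IH]; first by rewrite !big_ord0 addr0 mulr1.
rewrite !big_ord_recr/=; set p := \prod_(i < n) _ in IH *.
set s := \sum_(i < n) _ in IH *.
have p0 : 0 <= p by apply: prodr_ge0 => i _; have := g01 i; lra.
have s0 : 0 <= s by apply: sumr_ge0 => i _; have := g01 i; lra.
have [g0 g1] := andP (g01 n).
have : 0 <= p * (g n * (s + g n)) by rewrite !mulr_ge0// addr_ge0.
by nra.
Qed.

(** * Expectations as sums of tail probabilities *)

Section tail_sums.
Context d (T : measurableType d) (R : realType) (P : probability T R).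

Lemma integral_nat_tail (X : T -> nat) :
  (forall k, measurable [set x | (k < X x)%N]) ->
  (\int[P]_x (X x)%:R%:E = \sum_(k <oo) P [set x | (k < X x)%N])%E.
Proof.
move=> mX.
transitivity (\int[P]_x \sum_(k <oo) (\1_[set y | (k < X y)%N] x)%:E)%E.
  (* Split at [X x], the series has terms 1 before and 0 after. *)
  apply: eq_integral => x _; rewrite (nneseries_split 0 (X x)).
    rewrite add0n (_ : \big[_/_]_(_ <= _ <oo) _ = 0)%E.
      rewrite adde0 (eq_big_nat _ _ (F2 := fun=> 1%E)).
        by rewrite sumEFin big_mkord sumr_const card_ord.
      by move=> k /andP[_ kX]; rewrite indicE mem_set.
    apply: eseries0 => k Xk _; rewrite indicE memNset//=; lia.
  by move=> k _; rewrite lee_fin.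
rewrite integral_nneseries//.
  by apply: eq_eseriesr => k _; rewrite integral_indic// setIT.
by move=> k; apply/measurable_EFinP; exact: measurable_indic.
Qed.

Lemma nneseries_pinfty_partial (E : nat -> set T) :
  (forall k, measurable (E k)) -> (\sum_(k <oo) P (E k) = +oo)%E ->
  forall c, exists n, c <= \sum_(i < n) fine (P (E i)).
Proof.
move=> mE Eoo c; apply: contrapT => nE.
suff : (\sum_(k <oo) P (E k) <= c%:E)%E by rewrite Eoo leye_eq.
apply: lime_le; first exact: is_cvg_nneseries.
apply: nearW => n; rewrite big_mkord.
under eq_bigr do rewrite -(@fineK _ (P (E _))) ?fin_num_measure//.
rewrite sumEFin lee_fin leNgt; apply/negP => cn; apply: nE; exists n.
exact: ltW.
Qed.

Lemma nneseries_lty_partial (E : nat -> set T) :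
  (forall k, measurable (E k)) -> (\sum_(k <oo) P (E k) < +oo)%E ->
  exists c, forall n, \sum_(i < n) fine (P (E i)) <= c.
Proof.
move=> mE Eoo; exists (fine (\sum_(k <oo) P (E k))%E) => n.
rewrite -lee_fin fineK ?ge0_fin_numE ?nneseries_ge0//.
rewrite -sumEFin; under eq_bigr do rewrite fineK ?fin_num_measure//.
rewrite -(big_mkord xpredT (fun i => P (E i))).
exact: nneseries_lim_ge.
Qed.

End tail_sums.

(** * Independence of the sigma-algebra generated by cylinders *)

Section cylinders.
Context d (T : measurableType d) (R : realType) (P : probability T R).
Context (I : choiceType) (X : I -> T -> nat).
Hypothesis measurable_X : forall i A, measurable (X i @^-1` A).

(** A pi-system generating the sigma-algebra of the coordinates in [S], of the product shape that
    mutual independence handles. *)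
Definition cylinders (S : set I) : set (set T) :=
  [set B | exists (J : {fset I}) (A : I -> set nat),
     [set` J] `<=` S /\ B = \bigcap_(i in [set` J]) X i @^-1` A i].

Lemma cylinders_setI_closed S : setI_closed (cylinders S).
Proof.
move=> _ _ [J1 [A1 [J1S ->]]] [J2 [A2 [J2S ->]]].
exists (J1 `|` J2)%fset,
  (fun i => [set n | (i \in J1 -> A1 i n) /\ (i \in J2 -> A2 i n)]).
split=> [i /=|]; first by rewrite inE => /orP[/J1S|/J2S].
apply/seteqP; split=> [x [H1 H2] i _|x H].
  by split=> /= iJ; [exact: H1|exact: H2].
by split=> i /= iJ; have := H i; rewrite /= inE iJ ?orbT => /(_ isT) [h1 h2];
  [exact: h1|exact: h2].
Qed.

Lemma cylinders_measurable S B : cylinders S B -> measurable B.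
Proof.
by move=> [J [A [_ ->]]]; rewrite bigcap_fset; exact: bigsetI_measurable.
Qed.

Lemma sigma_cylinders_measurable S B : <<s cylinders S >> B -> measurable B.
Proof.
apply: smallest_sub; last exact: cylinders_measurable.
exact: sigma_algebra_measurable.
Qed.

Lemma sigma_cylinders_sub S S' B : S `<=` S' ->
  <<s cylinders S >> B -> <<s cylinders S' >> B.
Proof.
move=> SS'; apply: sub_sigma_algebra2 => _ [J [A [JS ->]]].
by exists J, A; split=> //; exact: subset_trans SS'.
Qed.

Lemma sigma_cylinders_preimage S i A : S i -> <<s cylinders S >> (X i @^-1` A).
Proof.
move=> Si; apply: sub_gen_smallest; exists [fset i]%fset, (fun=> A); split.
  by move=> j /=; rewrite inE => /eqP->.
by rewrite bigcap_fset big_seq_fset1.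
Qed.

Lemma sigma_cylindersT S : <<s cylinders S >> setT.
Proof. exact: (@measurableT _ (g_sigma_algebraType (cylinders S))). Qed.

Lemma sigma_cylindersC S A : <<s cylinders S >> A -> <<s cylinders S >> (~` A).
Proof. exact: (@measurableC _ (g_sigma_algebraType (cylinders S))). Qed.

Lemma sigma_cylindersI S A B : <<s cylinders S >> A -> <<s cylinders S >> B ->
  <<s cylinders S >> (A `&` B).
Proof. exact: (@measurableI _ (g_sigma_algebraType (cylinders S))). Qed.

Lemma sigma_cylinders_indep S (J : {fset I}) (A : I -> set nat) B :
  mutually_independent P X -> [set` J] `&` S = set0 -> <<s cylinders S >> B ->
  (P (B `&` \bigcap_(i in [set` J]) X i @^-1` A i) =
   P B * \prod_(i <- J) P (X i @^-1` A i))%E.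
Proof.
move=> indep JS; rewrite -indep; set C := \bigcap_(i in _) _.
have mC : measurable C by rewrite /C bigcap_fset; exact: bigsetI_measurable.
(* Dynkin's pi-lambda argument: [H] is a lambda-system containing the cylinders. *)
pose H := [set B | measurable B /\ P (B `&` C) = (P B * P C)%E].
suff : <<s cylinders S >> `<=` H by move=> /[apply] -[].
apply: lambda_system_subset => //; first exact: cylinders_setI_closed.
  apply/dynkin_lambda_system; split.
  - by split=> //; rewrite setTI probability_setT mul1e.
  - move=> E [mE PE]; split; first exact: measurableC.
    have := fine_probabilityID P mC mE.
    rewrite (setIC C E) PE (setIC C) fineM ?fin_num_measure//.
    have mEC : measurable (~` E `&` C).
      by apply: measurableI => //; exact: measurableC.
    rewrite probability_setC// => CE.
    rewrite -[LHS]fineK ?fin_num_measure// -[P E]fineK ?fin_num_measure//.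
    rewrite -[P C]fineK ?fin_num_measure// -EFinB -EFinM; congr EFin.
    by move: CE; lra.
  - move=> E tE HE; split.
      by apply: bigcupT_measurable => n; case: (HE n).
    have mE n : measurable (E n) by case: (HE n).
    rewrite setI_bigcupl measure_bigcup//=; last 2 first.
    + by move=> n _; exact: measurableI.
    + exact: trivIset_setIr.
    rewrite measure_bigcup//=.
    rewrite muleC -(@fineK _ (P C)) ?fin_num_measure// -nneseriesZl//.
    apply: eq_eseriesr => n _.
    by rewrite fineK ?fin_num_measure// muleC; case: (HE n).
move=> _ [J' [A' [J'S ->]]]; split.
  by rewrite bigcap_fset; exact: bigsetI_measurable.
rewrite /C !indep.
have JJ' : [disjoint J' & J]%fset.
  apply/fdisjointP => i iJ'; apply/negP => iJ.
  have : ([set` J] `&` S) i by split=> //; exact: J'S.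
  by rewrite JS.
(* As [J'] and [J] are disjoint, the two cylinders merge into one, whose probability factors. *)
have -> : (\bigcap_(i in [set` J']) X i @^-1` A' i) `&`
    (\bigcap_(i in [set` J]) X i @^-1` A i) =
    \bigcap_(i in [set` (J' `|` J)%fset])
      X i @^-1` (if i \in J' then A' i else A i).
  apply/seteqP; split=> x.
    move=> [H1 H2] i /=; rewrite inE.
    by case: ifPn => [iJ' _|_ /= iJ]; [exact: H1|exact: H2].
  move=> HH; split=> i /= iJ;
    have := HH i; rewrite /= inE iJ ?orbT => /(_ isT) //.
  by rewrite (negbTE (fdisjointP_sym JJ' _ iJ)).
have JJ'cat : perm_eq (J' `|` J)%fset (J' ++ J).
  apply: uniq_perm => //; last by move=> i; rewrite inE mem_cat.
  rewrite cat_uniq !fset_uniq/= andbT; apply/hasPn => i iJ.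
  exact: (fdisjointP_sym JJ').
rewrite indep (perm_big _ JJ'cat)/= big_cat/=.
congr (_ * _)%E; apply: eq_big_seq => i iJ.
  by rewrite iJ.
by case: ifPn => // iJ'; move/fdisjointP : JJ' => /(_ _ iJ'); rewrite iJ.
Qed.

End cylinders.

(** * The random steps and their past *)

Section steps.
Context d (T : measurableType d) (R : realType) (P : probability T R).
Context (Z W : T -> nat) (Zs Ws : nat -> T -> nat).
Hypothesis measurable_steps : forall i (A : set nat),
  measurable (ZWfamily Z W Zs Ws i @^-1` A).
Hypothesis indep_steps : mutually_independent P (ZWfamily Z W Zs Ws).
Hypothesis ident_steps : identically_distributed P (ZWfamily Z W Zs Ws).

(** Index [n] of [ZWfamily] belongs to site n + 1, so these are both steps at the sites 1, ...,
    k. *)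
Let before k : set (bool + bool * nat) :=
  [set i | if i is inr (_, n) then (n < k)%N else False].
Let past k := <<s cylinders (ZWfamily Z W Zs Ws) (before k) >>.
Let law (A : set nat) := fine (P (Z @^-1` A)).

Let law_steps i A : fine (P (ZWfamily Z W Zs Ws i @^-1` A)) = law A.
Proof. by rewrite (ident_steps i (inl true) A). Qed.

Let measurable_Z A : measurable (Z @^-1` A).
Proof. exact: (measurable_steps (inl true)). Qed.

Let lawC A : law (~` A) = 1 - law A.
Proof.
rewrite /law -preimage_setC probability_setC//.
by rewrite fineB ?fin_num_measure.
Qed.

Let law_ge0 A : 0 <= law A. Proof. exact: fine_probability_ge0. Qed.

Let law_le1 A : law A <= 1.
Proof. by have := law_ge0 (~` A); rewrite lawC; lra. Qed.

Let past_indepZ k A S : past k A ->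
  fine (P (A `&` Zs k.+1 @^-1` S)) = fine (P A) * law S.
Proof.
move=> pA; have mA := sigma_cylinders_measurable measurable_steps pA.
have dis : [set` [fset inr (true, k)]%fset] `&` before k = set0.
  by apply/seteqP; split=> // i [/=]; rewrite inE => /eqP -> /=; rewrite ltnn.
have := sigma_cylinders_indep measurable_steps (fun=> S) indep_steps dis pA.
rewrite bigcap_fset !big_seq_fset1 /= => ->.
by rewrite fineM ?fin_num_measure//; [rewrite -(law_steps (inr (true, k)))
  |exact: (measurable_steps (inr (true, k)))].
Qed.

Let indep_pair S i j A S1 S2 : i != j -> ~ S i -> ~ S j ->
  <<s cylinders (ZWfamily Z W Zs Ws) S >> A ->
  fine (P (A `&` (ZWfamily Z W Zs Ws i @^-1` S1 `&`
                  ZWfamily Z W Zs Ws j @^-1` S2))) =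
  fine (P A) * (law S1 * law S2).
Proof.
move=> ij Si Sj pA; have mA := sigma_cylinders_measurable measurable_steps pA.
have dis : [set` [fset i; j]%fset] `&` S = set0.
  by apply/seteqP; split=> // l [/=]; rewrite !inE => /orP[] /eqP ->.
have := sigma_cylinders_indep measurable_steps
  (fun l => if l == i then S1 else S2) indep_steps dis pA.
rewrite bigcap_fset !big_fsetU1/= ?inE// !big_seq_fset1 eqxx.
rewrite eq_sym (negbTE ij) => ->.
by rewrite !fineM ?fin_num_measure// ?law_steps// fin_numM// fin_num_measure.
Qed.

(** By complement: the two steps at a site miss [S] independently of each other and of the past. *)
Let past_indepU k A S : past k A ->
  fine (P (A `&` (Zs k.+1 @^-1` S `|` Ws k.+1 @^-1` S))) =
  fine (P A) * (1 - law (~` S) ^+ 2).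
Proof.
move=> pA; have mA := sigma_cylinders_measurable measurable_steps pA.
have mU : measurable (Zs k.+1 @^-1` S `|` Ws k.+1 @^-1` S).
  by apply: measurableU; [exact: (measurable_steps (inr (true, k)))
                         |exact: (measurable_steps (inr (false, k)))].
have := fine_probabilityID P mA mU.
have -> : ~` (Zs k.+1 @^-1` S `|` Ws k.+1 @^-1` S) =
  Zs k.+1 @^-1` (~` S) `&` Ws k.+1 @^-1` (~` S) by rewrite setCU.
have := @indep_pair (before k) (inr (true, k)) (inr (false, k)) A (~` S) (~` S).
by rewrite /= ltnn => /(_ isT notF notF pA) ->; rewrite expr2; lra.
Qed.

(** Such a square also bounds the chance that both steps at a site are bad; this is how the expected
    minimum enters. *)
Lemma min_tail k : fine (P [set x | (k < minn (Z x) (W x))%N]) =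
  fine (P [set x | (k < Z x)%N]) ^+ 2.
Proof.
have := @indep_pair set0 (inl true) (inl false) setT [set n | (k < n)%N]
  [set n | (k < n)%N] isT (fun f => f) (fun f => f).
rewrite setTI probability_setT mul1r -expr2 => <-; last exact: sigma_cylindersT.
congr (fine (P _)).
by apply/seteqP; split=> x /=; rewrite leq_min => /andP.
Qed.

(* S i is the set of steps that are good at distance i.+1 above the cut. *)
Lemma ae_long_step_over_cut (S : nat -> set nat) C M :
  (forall i, 0 < fine (P (Z @^-1` S i))) ->
  (forall i x, (Z x <= i)%N -> S (C + i)%N (Z x)) ->
  (\int[P]_x ((Z x)%:R)%:E = +oo)%E ->
  (\int[P]_x ((minn (Z x) (W x))%:R)%:E < +oo)%E ->
  {ae P, forall x, exists k, (k.+1 + M <= Zs k.+1 x)%N /\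
    forall i, S i (Zs (k + i).+2 x) \/ S i (Ws (k + i).+2 x)}.
Proof.
move=> S_gt0 SC EZ Emin.
have mZ k : measurable [set x | (k < Z x)%N].
  exact: (measurable_Z [set n | (k < n)%N]).
have mmin k : measurable [set x | (k < minn (Z x) (W x))%N].
  rewrite (_ : [set x | _] =
      [set x | (k < Z x)%N] `&` W @^-1` [set n | (k < n)%N]).
    by apply: measurableI => //; exact: (measurable_steps (inl false)).
  by apply/seteqP; split=> x /=; rewrite leq_min => /andP.
rewrite integral_nat_tail// in EZ; rewrite integral_nat_tail// in Emin.
have [c minc] := nneseries_lty_partial mmin Emin.
(* The probability that the step at site k + 1 reaches - M or lower. *)
pose g k := law [set n | (k.+1 + M <= n)%N].
pose q i := 1 - law (~` S i) ^+ 2.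
have q01 i : 0 < q i <= 1.
  have : 0 < law (S i) by exact: S_gt0.
  by have := law_le1 (S i); rewrite /q lawC; nra.
(* At distance C + i + 1 both steps can be bad only if both exceed [i]. *)
have qC i : 1 - q (C + i)%N <= fine (P [set x | (i < minn (Z x) (W x))%N]).
  rewrite /q subKr min_tail; apply: lerXn2r;
    rewrite ?nnegrE ?fine_probability_ge0//.
  apply: le_fine_probability => // x /=; rewrite ltnNge => nS.
  by apply/negP => /SC.
have [delta delta0 dq] := prod_lower_bound q01 qC minc.
have prodg m e : 0 < e -> exists n, \prod_(i < n) (1 - g (m + i)%N) <= e.
  apply: (@prod_1sub_small _ (fun i => g (m + i)%N)) => [i|b].
    by rewrite law_ge0 law_le1.
  (* The sum of [g (m + i)] omits the first m + M tail probabilities, each at most 1; the surplus m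
     + M pays for them. *)
  have [n bn] := nneseries_pinfty_partial mZ EZ (b + (m + M)%:R).
  exists n; have : \sum_(i < n) fine (P [set x | (i < Z x)%N]) <=
      \sum_(i < m + M + n) fine (P [set x | (i < Z x)%N]).
    rewrite addnC big_split_ord/= lerDl sumr_ge0// => i _.
    exact: fine_probability_ge0.
  rewrite big_split_ord/=.
  have : \sum_(i < m + M) fine (P [set x | (i < Z x)%N]) <= (m + M)%:R.
    rewrite -[X in X%:R]card_ord -sumr_const; apply: ler_sum => i _.
    exact: (law_le1 [set n | (i < n)%N]).
  have -> : \sum_(i < n) fine (P [set x | (m + M + i < Z x)%N]) =
      \sum_(i < n) g (m + i)%N.
    apply: eq_bigr => i _; congr (fine (P _)); apply/seteqP; split=> x /=; lia.
  by lra.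
have FS k A : past k A -> past k.+1 A.
  by apply: sigma_cylinders_sub => -[//|[b n]] /= /ltnW.
(* Index [k] stands for site k + 1, and condition [i] for the steps at site k + i + 2, at distance i
   + 1 above it. *)
apply: (@ae_marked_cut _ _ _ P past
  (fun k => Zs k.+1 @^-1` [set n | (k.+1 + M <= n)%N])
  (fun k i => Zs (k + i).+2 @^-1` S i `|` Ws (k + i).+2 @^-1` S i)
  g q delta) => //.
- by move=> k A; exact: sigma_cylinders_measurable.
- by move=> k; exact: sigma_cylindersT.
- by move=> k A; exact: sigma_cylindersC.
- by move=> k A A'; exact: sigma_cylindersI.
- move=> k; apply: (@sigma_cylinders_preimage _ _ _ _ _ (inr (true, k))).
  exact: ltnSn.
- move=> k i; rewrite -[_ `|` _]setCK setCU; apply: sigma_cylindersC.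
  apply: sigma_cylindersI; apply: sigma_cylindersC.
    apply: (@sigma_cylinders_preimage _ _ _ _ _ (inr (true, (k + i).+1))).
    exact: ltnSn.
  apply: (@sigma_cylinders_preimage _ _ _ _ _ (inr (false, (k + i).+1))).
  exact: ltnSn.
- by move=> k A; exact: past_indepZ.
- by move=> k i A; exact: past_indepU.
Qed.

End steps.

(** * From cuts to the growth of the number of leaves *)

Theorem theorem5 (d : measure_display) (T : measurableType d) (R : realType)
  (P : probability T R) (Z W : T -> nat) (Zs Ws : nat -> T -> nat)
  (Hmeas : forall (i : bool + (bool * nat)) (A : set nat),
      measurable (ZWfamily Z W Zs Ws i @^-1` A))
  (Hpos : forall (i : bool + (bool * nat)) (x : T), (0 < ZWfamily Z W Zs Ws i x)%N)
  (Hindep : mutually_independent P (ZWfamily Z W Zs Ws))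
  (Hident : identically_distributed P (ZWfamily Z W Zs Ws))
  (Haperiodic : forall k : nat,
      (forall m : nat, (0 < P (Z @^-1` [set m]))%E -> (k %| m)%N) -> k = 1%N)
  (HEZ : (\int[P]_x ((Z x)%:R)%:E = +oo)%E)
  (HEmin : (\int[P]_x ((minn (Z x) (W x))%:R)%:E < +oo)%E) :
  {ae P, forall x : T, forall K : nat,
      \forall n \near \oo,
        (K <= Lambda (fun k => Zs k x) (fun k => Ws k x) n%:Z)%N}.
Proof.
pose supp : set nat := [set m | (0 < P (Z @^-1` [set m]))%E].
have Zpos x : (0 < Z x)%N by exact: (Hpos (inl true)).
have [C suppC] := @sums_of_eventually supp Haperiodic.
have good_gt0 i : 0 < fine (P (Z @^-1` good_step supp i.+1)).
  have mZ A : measurable (Z @^-1` A) by exact: (Hmeas (inl true)).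
  (* Outside the semigroup every step is good. Inside it, i + 1 = s + m with [s] in the support and
     [m] in the semigroup, so [s] is a good step. *)
  have [Si|nSi] := pselect (sums_of supp i.+1); last first.
    rewrite (_ : good_step _ _ = setT) ?preimage_setT ?probability_setT//.
    by apply/seteqP; split=> // s _ _.
  have [s [m [supps Sm sm]]] : exists s m,
      [/\ supp s, sums_of supp m & i.+1 = (s + m)%N].
    by move: Si; move Ei : i.+1 => n Sn; case: Sn Ei => // s m; exists s, m.
  have s0 : (0 < s)%N.
    case: s supps {sm} => // supp0; move: supp0; rewrite /supp /=.
    rewrite (_ : _ @^-1` _ = set0) ?measure0 ?ltxx//.
    by apply/seteqP; split=> // x /= Zx; have := Zpos x; rewrite Zx.
  apply: (@lt_le_trans _ _ (fine (P (Z @^-1` [set s])))).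
    by rewrite fine_gt0// supps/= (le_lt_trans (probability_le1 P (mZ _)))// ltry.
  apply: le_fine_probability => // x /= -> _ _.
  by rewrite s0 sm leq_addr addKn.
(* Such a step lands at a distance above [C], hence in the semigroup. *)
have goodC i x : (Z x <= i)%N -> good_step supp (C + i).+1 (Z x).
  by move=> Zi _ _; split; [rewrite Zpos/=; lia|apply: suppC; lia].
(* There are countably many [M], so one null set serves them all. *)
have := ae_foralln (fun M => ae_long_step_over_cut Hmeas Hindep Hident M
  good_gt0 goodC HEZ HEmin).
apply: filterS => x cuts; apply: (@Lambda_ge _ _ C) => [j|M].
  by split; [exact: (Hpos (inr (true, j)))|exact: (Hpos (inr (false, j)))].
have [k [kM kS]] := cuts M; exists k; split=> // n kn.
have -> : n = (k.+1 + (n - k.+1))%N by lia.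
apply: (@inT_good_steps supp); last by apply: suppC; lia.
(* At distance 0 the condition is vacuous; distance i + 1 above site k + 1 is site k + i + 2. *)
by case=> [|i]; [left|rewrite addSn addnS; exact: kS].
Qed.
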